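(* Let $Q$ be a weakly multiplicative open quantal frame. Then the set $\Gamma(Q)$ of local bisections of $Q$, with the product of local bisections and the inverse operation $\sigma\mapsto\sigma^{-1}$, is a complete and infinitely distributive inverse semigroup (an abstract complete pseudogroup), and the following conditions are satisfied: 1. $\varepsilon\cdot a=a\cdot\varepsilon=a$ for all $a\in Q$, where $\varepsilon=(1,u)$ is the local bisection with $u^*=\upsilon$. 2. The natural order of $\Gamma(Q)$ is given by restriction, i.e. $\sigma\le\tau$ if and only if $U_\sigma\le U_\tau$ and $s_\sigma$ is the restriction of $s_\tau$ to $\widetilde{U_\sigma}$. 3. The semilattice of idempotents of $\Gamma(Q)$ is isomorphic to $R(Q)$. 4. If $\sigma\le\tau$ in $\Gamma(Q)$ then $\sigma\cdot a\le\tau\cdot a$ for all $a\in Q$.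
   Context: A quantale is a sup-lattice with an associative multiplication preserving joins in each variable (not necessarily unital). An involutive quantal frame $Q$ is a quantale with a join-preserving involution ($a^{**}=a$, $(ab)^*=b^*a^*$) whose underlying lattice is a frame; $1$ is its top. $R(Q)=\{a\in Q:a1\le a\}$, a subframe of $Q$. $Q$ is open if, with $\upsilon(a)=\bigvee_{xy^*\le a}x\wedge y$, for all $a,b,c\in Q$: $b(a1\wedge c)=(b\wedge1a^* )c$; $\upsilon(a)\in R(Q)$; $\bigvee_{xx^*x\le a}x=a$; $(a1\wedge b)c=a1\wedge bc$. Regard frames also as locales; for a map of locales $f$, $f^*$ is its inverse image homomorphism, while for $a\in Q$, $a^*$ is the involute. Let $d,r:Q\to R(Q)$ and $i:Q\to Q$ be the locale maps with $d^*(z)=z$, $r^*(z)=z^*$ ($z\in R(Q)$), $i^*(a)=a^*$. For $U\in R(Q)$, $\widetilde U$ is the locale with frame $\{z\in R(Q):z\le U\}$ and $k_U:\widetilde U\to R(Q)$ is the open inclusion, $k_U^*(z)=z\wedge U$. A local bisection of $Q$ is a pair $\sigma=(U,s)$, $U\in R(Q)$, with $s:\widetilde U\to Q$ a map of locales such that $d\circ s=k_U$ and $r\circ s$ is an open regular monomorphism of locales. Then $r\circ s=k_V\circ\alpha$ for a unique $V\in R(Q)$ and isomorphism $\alpha:\widetilde U\to\widetilde V$; put $t=s\circ\alpha^{-1}$ and $\sigma^{-1}=(V,i\circ t)$, again a local bisection. Write $U_\sigma,s_\sigma,\ldots$ for the data of $\sigma$. $\Gamma(Q)$ is the set of local bisections.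 For $\sigma\in\Gamma(Q)$, $a\in Q$: $$\sigma\cdot a=\bigvee_{x^*y\le a}s_\sigma^*(x)\wedge y,\qquad a\cdot\sigma^{-1}=\bigvee_{xy\le a}x\wedge s_\sigma^*(y)^*.$$ For $\sigma,\tau\in\Gamma(Q)$ let $f(a)=\bigvee_{xy\le a}s_\sigma^*(x\wedge s_\tau^*(y)^* )=s_\sigma^*(a\cdot\tau^{-1})$. If $f$ preserves joins, the product $\sigma\tau$ is the local bisection with $U_{\sigma\tau}=s_\sigma^*(U_\tau^* )$ and $s_{\sigma\tau}^*=f$. $Q$ is weakly multiplicative if for all $\sigma,\tau,\nu\in\Gamma(Q)$: (1) $\upsilon$ preserves joins (so that there is a locale map $u:R(Q)\to Q$ with $u^*=\upsilon$, and $\varepsilon=(1,u)$ is a local bisection with $\varepsilon^{-1}=\varepsilon$); (2) $\sigma\cdot(-)$ preserves joins (so that all products are defined); (3) $(\sigma\tau)\nu=\sigma(\tau\nu)$. Elements $\sigma,\tau$ of an inverse semigroup are compatible if $\sigma\tau^{-1}$ and $\sigma^{-1}\tau$ are idempotent. The inverse semigroup is complete if every family of pairwise compatible elements has a join in the natural order, and infinitely distributive if multiplication distributes over such joins. *)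

(* Defs.v *)
From HB Require Import structures.
From mathcomp Require Import all_boot all_order.
From mathcomp Require Import mathcomp_extra boolp classical_sets.

Set Implicit Arguments.
Unset Strict Implicit.
Unset Printing Implicit Defensive.

Import Order.TTheory.
Local Open Scope group_scope.
Local Open Scope order_scope.

HB.mixin Record isFrame d T of Order.TBLattice d T := {
  Sup : set T -> T;
  Sup_ub : forall (A : set T) x, A x -> x <= Sup A;
  Sup_le : forall (A : set T) y, (forall x, A x -> x <= y) -> Sup A <= y;
  meet_Sup : forall x (A : set T), x `&` Sup A = Sup [set (x `&` y)%O | y in A]%classic
}.

#[short(type="frameType")]
HB.structure Definition Frame d := {T of Order.TBLattice d T & isFrame d T}.

Arguments Sup_ub {d s A x} _.
Arguments Sup_le {d s A y} _.

Notation "\Sup_ ( x , y | P ) F" :=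
  (Sup [set z | exists x y, P%O /\ F%O = z]%classic)
  (at level 36, F at level 36, x binder, y binder,
   format "\Sup_ ( x ,  y  |  P )  F") : order_scope.

Definition preserves_Sup d d' (L : frameType d) (M : frameType d') (f : L -> M) :=
  forall A : set L, f (Sup A) = Sup (f @` A)%classic.

Section FrameTheory.
Variables (d : Order.disp_t) (L : frameType d).
Implicit Types (x y z : L) (A B : set L).

Lemma Sup_meet A B :
  Sup A `&` Sup B = Sup [set z | exists x y, (A x /\ B y) /\ z = (x `&` y)%O]%classic.
Proof.
apply/le_anti/andP; split.
  rewrite meet_Sup; apply: Sup_le => _ [y By <-].
  rewrite meetC meet_Sup; apply: Sup_le => _ [x Ax <-].
  by rewrite meetC; apply: Sup_ub; exists x, y.
apply: Sup_le => _ [x [y [[Ax By] ->]]].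
by apply: leI2; apply: Sup_ub.
Qed.

Lemma join_Sup x y : x `|` y = Sup [set z | z = x \/ z = y]%classic.
Proof.
apply/le_anti/andP; split; last by apply: Sup_le => _ [] ->; rewrite ?leUl ?leUr.
by rewrite leUx; apply/andP; split; apply: Sup_ub; [left|right].
Qed.

Lemma bot_Sup : \bot = Sup set0 :> L.
Proof. by apply/le_anti; rewrite le0x; apply: Sup_le. Qed.

Lemma preserves_Sup_le d' (M : frameType d') (f : L -> M) x y :
  preserves_Sup f -> x <= y -> f x <= f y.
Proof.
move=> fS /join_r <-; rewrite join_Sup fS; apply: Sup_ub; exists x => //.
by left.
Qed.

End FrameTheory.

(* A map of locales [X -> Y] is given by its inverse image, a frame
   homomorphism from [Y] to [X]. *)
Record locmap d d' (X : frameType d) (Y : frameType d') := Locmap {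
  linv : Y -> X;
  linv_top : linv \top = \top;
  linv_meet : forall x y, linv (x `&` y) = linv x `&` linv y;
  linv_Sup : preserves_Sup linv
}.

Section LocmapTheory.
Variables (d1 d2 : Order.disp_t) (X : frameType d1) (Y : frameType d2).
Implicit Types f g : locmap X Y.

Lemma locmap_ext f g : linv f =1 linv g -> f = g.
Proof.
case: f g => f f1 f2 f3 [g g1 g2 g3] /= /funext fg.
by case: g / fg in g1 g2 g3 *; congr Locmap; apply: Prop_irrelevance.
Qed.

Lemma linv_le f x y : x <= y -> linv f x <= linv f y.
Proof. by move=> /meet_l xy; rewrite leEmeet -linv_meet xy. Qed.

End LocmapTheory.

Section Locales.
Variables (d1 d2 d3 : Order.disp_t).
Variables (X : frameType d1) (Y : frameType d2) (Z : frameType d3).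

Fact lid_Sup : preserves_Sup (id : X -> X).
Proof. by move=> A; rewrite image_id. Qed.
Definition lid : locmap X X := Locmap erefl (fun _ _ => erefl) lid_Sup.

Variables (g : locmap Y Z) (f : locmap X Y).
Fact lcomp_top : linv f (linv g \top) = \top.
Proof. by rewrite !linv_top. Qed.
Fact lcomp_meet x y :
  linv f (linv g (x `&` y)) = linv f (linv g x) `&` linv f (linv g y).
Proof. by rewrite !linv_meet. Qed.
Fact lcomp_Sup : preserves_Sup (fun z => linv f (linv g z)).
Proof. by move=> A; rewrite !linv_Sup image_comp. Qed.
Definition lcomp : locmap X Z := Locmap lcomp_top lcomp_meet lcomp_Sup.

End Locales.
Arguments lid {d1} X.

(* Openness: a left adjoint of the inverse image, with Frobenius reciprocity. *)
Definition open_map d1 d2 (X : frameType d1) (Y : frameType d2)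
    (f : locmap X Y) : Prop :=
  exists f_ : X -> Y,
    (forall x y, f_ x <= y <-> x <= linv f y) /\
    (forall x y, f_ (x `&` linv f y) = f_ x `&` y).

Definition is_equalizer d1 d2 d3 (E : frameType d1) (X : frameType d2)
    (Y : frameType d3) (e : locmap E X) (g h : locmap X Y) : Prop :=
  lcomp g e = lcomp h e /\
  forall d (W : frameType d) (w : locmap W X), lcomp g w = lcomp h w ->
    exists! v : locmap W E, lcomp e v = w.

Definition regular_mono d1 d2 (E : frameType d1) (X : frameType d2)
    (e : locmap E X) : Prop :=
  exists d (Y : frameType d) (g h : locmap X Y), is_equalizer e g h.

Section OpenSub.
Variables (d : Order.disp_t) (X : frameType d) (u : X).

(* The frame of the open sublocale [u], i.e. the down-set of [u]. *)
Record open_sub := OpenSub { osval : X; osvalP : osval <= u }.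

HB.instance Definition _ := [isSub for osval].
HB.instance Definition _ := [Choice of open_sub by <:].
HB.instance Definition _ := Order.SubChoice_isSubPOrder.Build d X _ d open_sub.

Let le_u : pred X := fun x => x <= u.
Fact open_sub_meet : {in le_u &, forall x y, x `&` y \in le_u}.
Proof. by move=> x y xu yu; apply: le_trans (leIl _ _) xu. Qed.
Fact open_sub_join : {in le_u &, forall x y, x `|` y \in le_u}.
Proof. by move=> x y xu yu; rewrite unfold_in /le_u leUx; apply/andP; split. Qed.
HB.instance Definition _ := Order.SubPOrder_isSubLattice.Build d X _ d open_sub
  open_sub_meet open_sub_join.
HB.instance Definition _ := Order.SubPOrder_isBSubLattice.Build d X _ d open_sub
  (le0x u).
Lemma osval_meet (x y : open_sub) : osval (x `&` y) = osval x `&` osval y.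
Proof. by []. Qed.
Lemma le_osval (x y : open_sub) : (osval x <= osval y) = (x <= y).
Proof. by rewrite -Order.le_val. Qed.
Lemma osval_inj : injective osval.
Proof. exact: val_inj. Qed.
Fact open_sub_lex1 (x : open_sub) : x <= OpenSub (lexx u).
Proof. by rewrite -Order.le_val; exact: osvalP. Qed.
HB.instance Definition _ := Order.hasTop.Build d open_sub open_sub_lex1.

Fact open_sub_Sup_subproof (A : set open_sub) : Sup (osval @` A)%classic <= u.
Proof. by apply: Sup_le => _ [x _ <-]; apply: osvalP. Qed.
Definition open_sub_Sup A := OpenSub (open_sub_Sup_subproof A).
Fact open_sub_Sup_ub (A : set open_sub) x : A x -> x <= open_sub_Sup A.
Proof. by move=> Ax; rewrite -Order.le_val; apply: Sup_ub; exists x. Qed.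
Fact open_sub_Sup_le (A : set open_sub) y :
  (forall x, A x -> x <= y) -> open_sub_Sup A <= y.
Proof.
move=> h; rewrite -Order.le_val; apply: Sup_le => _ [x /h xy <-].
by rewrite -Order.le_val in xy.
Qed.
Fact open_sub_meet_Sup x (A : set open_sub) :
  x `&` open_sub_Sup A = open_sub_Sup [set (x `&` y)%O | y in A]%classic.
Proof.
apply: val_inj; transitivity (osval x `&` Sup (osval @` A)%classic) => //.
by rewrite meet_Sup /= !image_comp.
Qed.
HB.instance Definition _ := isFrame.Build d open_sub
  open_sub_Sup_ub open_sub_Sup_le open_sub_meet_Sup.

End OpenSub.

Section OpenSubMaps.
Variables (d : Order.disp_t) (X : frameType d) (u : X).

(* The open inclusion [k_u] of the open sublocale [u]. *)
Definition kmap_inv (z : X) : open_sub u := OpenSub (leIr u z).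
Fact kmap_top : kmap_inv \top = \top.
Proof. by apply: osval_inj; rewrite /= meet1x. Qed.
Fact kmap_meet x y : kmap_inv (x `&` y) = kmap_inv x `&` kmap_inv y.
Proof. by apply: osval_inj; rewrite osval_meet /= meetACA meetxx. Qed.
Fact kmap_Sup : preserves_Sup kmap_inv.
Proof.
move=> A; apply: osval_inj; rewrite /= meetC meet_Sup image_comp; congr Sup.
by apply: eq_imagel => x _ /=; rewrite meetC.
Qed.
Definition kmap : locmap (open_sub u) X := Locmap kmap_top kmap_meet kmap_Sup.

End OpenSubMaps.

Section OpenIncl.
Variables (d : Order.disp_t) (X : frameType d) (u v : X) (uv : u <= v).

Definition oincl_inv (z : open_sub v) : open_sub u := kmap_inv u (osval z).
Fact oincl_top : oincl_inv \top = \top.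
Proof. by apply: osval_inj; rewrite /= meet_r. Qed.
Fact oincl_meet x y : oincl_inv (x `&` y) = oincl_inv x `&` oincl_inv y.
Proof. by rewrite /oincl_inv osval_meet kmap_meet. Qed.
Fact oincl_Sup : preserves_Sup oincl_inv.
Proof. by move=> A; rewrite /oincl_inv kmap_Sup image_comp. Qed.
Definition oincl : locmap (open_sub u) (open_sub v) :=
  Locmap oincl_top oincl_meet oincl_Sup.

End OpenIncl.

Section OrdinalFrame.
Variable n : nat.
Local Notation I := 'I_n.+1.

(* The library declares the total order and the bounds of ['I_n.+1] without
   their join. *)
HB.instance Definition _ := Order.Total.on I.

Definition ord_Sup (A : set I) : I := \join_(i | `[<A i>]) i.

Lemma ord_Sup_mem A : ord_Sup A = \bot \/ A (ord_Sup A).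
Proof.
apply: (big_ind (fun x => x = \bot \/ A x)) => [|x y hx hy|i /asboolP]; [by left| |by right].
by have [xy|yx] := leP x y; rewrite ?(join_r xy) // ?(join_l (ltW yx)).
Qed.
Fact ord_Sup_ub A x : A x -> x <= ord_Sup A.
Proof. by move=> Ax; apply: (joins_min (j := x)) => //; apply/asboolP. Qed.
Fact ord_Sup_le A y : (forall x, A x -> x <= y) -> ord_Sup A <= y.
Proof. by move=> h; apply/joinsP => i /asboolP /h. Qed.
Fact ord_meet_Sup x A :
  x `&` ord_Sup A = ord_Sup [set (x `&` y)%O | y in A]%classic.
Proof.
apply/le_anti/andP; split.
  have [->|h] := ord_Sup_mem A; first by rewrite meetx0 le0x.
  by apply: ord_Sup_ub; exists (ord_Sup A).
by apply: ord_Sup_le => _ [y Ay <-]; apply: leI2 => //; apply: ord_Sup_ub.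
Qed.
HB.instance Definition _ := isFrame.Build _ I ord_Sup_ub ord_Sup_le ord_meet_Sup.

End OrdinalFrame.

Section OrdinalMap.
Variables (n : nat) (d : Order.disp_t) (Y : frameType d) (l : 'I_n.+1 -> Y).
Hypothesis l_mono : forall i j, i <= j -> l i <= l j.
Hypotheses (l_bot : l \bot = \bot) (l_top : l \top = \top).

Fact ord_map_meet i j : l (i `&` j) = l i `&` l j.
Proof.
have [ij|/ltW ji] := leP i j; first by rewrite meet_l // l_mono.
by rewrite meet_r // l_mono.
Qed.
Fact ord_map_Sup : preserves_Sup l.
Proof.
move=> A; apply/le_anti/andP; split; last first.
  by apply: Sup_le => _ [i Ai <-]; apply: l_mono; apply: Sup_ub.
have [h|h] := ord_Sup_mem A; last by apply: Sup_ub; exists (ord_Sup A).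
by rewrite -[Sup A]/(ord_Sup A) h l_bot le0x.
Qed.
Definition ord_map : locmap Y 'I_n.+1 := Locmap l_top ord_map_meet ord_map_Sup.

End OrdinalMap.

Section OpenRegularMono.
Variables (d1 d2 : Order.disp_t) (X : frameType d1) (Y : frameType d2).
Variables (f : locmap X Y) (f_ : X -> Y).
Hypothesis f_adj : forall x y, f_ x <= y <-> x <= linv f y.
Hypothesis f_frob : forall x y, f_ (x `&` linv f y) = f_ x `&` y.

Let f_unit x : x <= linv f (f_ x).
Proof. exact/f_adj. Qed.
Let f_mono x y : x <= y -> f_ x <= f_ y.
Proof. by move=> xy; apply/f_adj; apply: le_trans xy (f_unit y). Qed.
Let f_V y : f_ (linv f y) = f_ \top `&` y.
Proof. by rewrite -f_frob meet1x. Qed.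

Lemma regular_mono_linv_surj : regular_mono f -> forall x, linv f (f_ x) = x.
Proof.
case=> d [Z] [g] [h] [gh univ].
pose V := f_ \top.
have Ek : lcomp g (kmap V) = lcomp h (kmap V).
  apply: locmap_ext => z; apply: osval_inj; rewrite /= /V ![_ `&` f_ _]meetC -!f_V; congr f_.
  by have /(congr1 (fun k => linv k z)) := gh.
have [v [fv _]] := univ _ _ _ Ek.
have p1 : linv f (osval (\top : open_sub V)) = \top.
  by apply/le_anti; rewrite lex1 f_unit.
have p2 (x y : open_sub V) : linv f (osval (x `&` y)) =
    linv f (osval x) `&` linv f (osval y).
  by rewrite osval_meet linv_meet.
have p3 : preserves_Sup (fun x : open_sub V => linv f (osval x)).
  by move=> A; rewrite /= linv_Sup image_comp.
pose p := Locmap p1 p2 p3 : locmap X (open_sub V).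
have kp : lcomp (kmap V) p = f.
  apply: locmap_ext => y /=.
  by rewrite linv_meet [linv f V](p1 : linv f V = \top) meetx1.
have [w [_ wU]] := univ _ _ f gh.
have /wU w1 : lcomp f (lid X) = f by apply: locmap_ext.
have /wU w2 : lcomp f (lcomp v p) = f.
  rewrite -[RHS]kp -fv; exact: locmap_ext.
move=> x; have /(congr1 (fun k => linv k x)) /= : lid X = lcomp v p.
  by rewrite -w1 -w2.
move=> /esym xE; rewrite -{2}xE -{1}xE; set y := osval _.
apply/le_anti/andP; split; last exact: f_unit.
by apply: linv_le; apply/f_adj.
Qed.

Hypothesis f_surj : forall x, linv f (f_ x) = x.

Lemma regular_mono_open : regular_mono f.
Proof.
pose V := f_ \top.
pose l (b : Y) (i : 'I_3) : Y :=
  if i == 0%N :> nat then \bot else if i == 1%N :> nat then b else \top.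
have l_mono b i j : i <= j -> l b i <= l b j.
  case: i j => [[|[|[|//]]] ?] [[|[|[|//]]] ?] //= _;
    by rewrite /l /= ?le0x ?lex1.
pose g b := ord_map (l_mono b) erefl erefl.
exists _, 'I_3, (g V), (g \top); split.
  apply: locmap_ext => i /=; rewrite /l; do 2! [case: ifP => // _].
  by rewrite f_surj linv_top.
move=> d W w /(congr1 (fun k => linv k (inord 1))).
rewrite /= /l !inordK //= linv_top => wV.
have v2 x y : linv w (f_ (x `&` y)) = linv w (f_ x) `&` linv w (f_ y).
  by rewrite -{1}[y]f_surj f_frob linv_meet.
have v3 : preserves_Sup (fun x => linv w (f_ x)).
  move=> A; rewrite -image_comp -linv_Sup; congr (linv w _).
  apply/le_anti/andP; split.
    apply/f_adj; apply: Sup_le => x Ax; apply/f_adj.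
    by apply: Sup_ub; exists x.
  by apply: Sup_le => _ [x Ax <-]; apply: f_mono; apply: Sup_ub.
exists (Locmap wV v2 v3); split.
  by apply: locmap_ext => y /=; rewrite f_V linv_meet wV meet1x.
by move=> v vw; apply: locmap_ext => x /=; rewrite -vw /= f_surj.
Qed.

End OpenRegularMono.

Lemma kmap_open d (X : frameType d) (u : X) : open_map (kmap u).
Proof.
exists (@osval _ _ u); split=> x y.
  by rewrite -[x <= _]le_osval /= lexI osvalP andbT.
by rewrite osval_meet /= meetCA [X in _ `&` X]meet_l 1?meetC // osvalP.
Qed.
Lemma kmap_regular_mono d (X : frameType d) (u : X) : regular_mono (kmap u).
Proof.
apply: (@regular_mono_open _ _ _ _ _ (@osval _ _ u)) => x.
- move=> y; by rewrite -[x <= _]le_osval /= lexI osvalP andbT.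
- by move=> y; rewrite osval_meet /= meetCA [X in _ `&` X]meet_l 1?meetC // osvalP.
- by apply: osval_inj; rewrite /= meet_l // osvalP.
Qed.

HB.mixin Record isInvolutiveQuantal d Q of Frame d Q & Semigroup Q := {
  mul_Supl : forall (A : set Q) (b : Q), Sup A * b = Sup [set a * b | a in A]%classic;
  mul_Supr : forall (a : Q) (B : set Q), a * Sup B = Sup [set a * b | b in B]%classic;
  star : Q -> Q;
  starK : involutive star;
  starM : forall a b : Q, star (a * b) = star b * star a;
  star_Sup : forall A : set Q, star (Sup A) = Sup (star @` A)%classic
}.

#[short(type="involutiveQuantalFrameType")]
HB.structure Definition InvolutiveQuantalFrame d :=
  {Q of Frame d Q & Semigroup Q & isInvolutiveQuantal d Q}.

Notation "a ^*" := (star a) : order_scope.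

Section QuantalFrameTheory.
Variables (d : Order.disp_t) (Q : involutiveQuantalFrameType d).
Implicit Types a b c x y z : Q.

Lemma mulSl c : preserves_Sup (fun a => a * c).
Proof. by move=> A; rewrite mul_Supl. Qed.
Lemma mulSr c : preserves_Sup (fun a => c * a).
Proof. by move=> A; rewrite mul_Supr. Qed.

Lemma le_mul a b x y : a <= b -> x <= y -> a * x <= b * y.
Proof.
move=> ab xy; apply: (le_trans (y := b * x)).
  exact: (preserves_Sup_le (mulSl x) ab).
exact: (preserves_Sup_le (mulSr b) xy).
Qed.

Lemma star_le a b : a <= b -> a^* <= b^*.
Proof. by apply: preserves_Sup_le; exact: star_Sup. Qed.

Lemma le_star a b : (a^* <= b) = (a <= b^*).
Proof. by apply/idP/idP => /star_le; rewrite starK. Qed.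

Lemma star_top : (\top : Q)^* = \top.
Proof. by apply/le_anti; rewrite lex1 -le_star lex1. Qed.

Lemma star_meet a b : (a `&` b)^* = a^* `&` b^*.
Proof.
apply/le_anti/andP; split.
  by rewrite lexI; apply/andP; split; apply: star_le; rewrite ?leIl ?leIr.
by rewrite -le_star lexI !le_star; apply/andP; split; rewrite ?leIl ?leIr.
Qed.

End QuantalFrameTheory.

(* [R(Q)], the right-sided elements. *)
Section RightSided.
Variables (d : Order.disp_t) (Q : involutiveQuantalFrameType d).

Record rside := RSide { rval : Q; rvalP : rval * \top <= rval }.

HB.instance Definition _ := [isSub for rval].
HB.instance Definition _ := [Choice of rside by <:].
HB.instance Definition _ := Order.SubChoice_isSubPOrder.Build d Q _ d rside.

Let right_sided : pred Q := fun a => a * \top <= a.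
Fact rside_meet : {in right_sided &, forall x y, x `&` y \in right_sided}.
Proof.
move=> x y xR yR; rewrite unfold_in /right_sided lexI; apply/andP; split.
  by apply: le_trans xR; apply: le_mul => //; apply: leIl.
by apply: le_trans yR; apply: le_mul => //; apply: leIr.
Qed.
Fact Sup_rside (A : set Q) : (forall x, A x -> x * \top <= x) ->
  Sup A * \top <= Sup A.
Proof.
move=> AR; rewrite mul_Supl; apply: Sup_le => _ [x Ax <-].
exact: le_trans (AR x Ax) (Sup_ub Ax).
Qed.
Fact rside_join : {in right_sided &, forall x y, x `|` y \in right_sided}.
Proof.
by move=> x y xR yR; rewrite unfold_in /right_sided join_Sup; apply: Sup_rside
  => _ [] ->.
Qed.
Fact rside_bot : \bot \in right_sided.
Proof. by rewrite unfold_in /right_sided bot_Sup; apply: Sup_rside. Qed.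
Fact rside_top : \top \in right_sided.
Proof. by rewrite unfold_in /right_sided lex1. Qed.
HB.instance Definition _ := Order.SubPOrder_isSubLattice.Build d Q _ d rside
  rside_meet rside_join.
HB.instance Definition _ := Order.SubPOrder_isTBSubLattice.Build d Q _ d rside
  rside_bot rside_top.

Lemma rval_meet (x y : rside) : rval (x `&` y) = rval x `&` rval y.
Proof. by []. Qed.
Lemma rval_top : rval \top = \top.
Proof. by []. Qed.
Lemma rval_inj : injective rval.
Proof. exact: val_inj. Qed.

Fact rside_Sup_subproof (A : set rside) :
  Sup (rval @` A)%classic * \top <= Sup (rval @` A)%classic.
Proof. by apply: Sup_rside => _ [x _ <-]; apply: rvalP. Qed.
Definition rside_Sup A := RSide (rside_Sup_subproof A).
Fact rside_Sup_ub (A : set rside) x : A x -> x <= rside_Sup A.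
Proof. by move=> Ax; rewrite -Order.le_val; apply: Sup_ub; exists x. Qed.
Fact rside_Sup_le (A : set rside) y :
  (forall x, A x -> x <= y) -> rside_Sup A <= y.
Proof.
move=> h; rewrite -Order.le_val; apply: Sup_le => _ [x /h xy <-].
by rewrite -Order.le_val in xy.
Qed.
Fact rside_meet_Sup x (A : set rside) :
  x `&` rside_Sup A = rside_Sup [set (x `&` y)%O | y in A]%classic.
Proof.
apply: val_inj; transitivity (rval x `&` Sup (rval @` A)%classic) => //.
by rewrite meet_Sup /= !image_comp.
Qed.
HB.instance Definition _ := isFrame.Build d rside
  rside_Sup_ub rside_Sup_le rside_meet_Sup.

(* The locale maps [d], [r : Q -> R(Q)] and [i : Q -> Q]. *)
Definition dmap : locmap Q rside :=
  @Locmap _ _ Q rside rval erefl (fun _ _ => erefl) (fun _ => erefl).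

Fact rmap_meet (x y : rside) : (rval (x `&` y))^* = (rval x)^* `&` (rval y)^*.
Proof. exact: star_meet. Qed.
Fact rmap_Sup : preserves_Sup (fun z : rside => (rval z)^*).
Proof. by move=> A; rewrite /= star_Sup image_comp. Qed.
Definition rmap : locmap Q rside :=
  @Locmap _ _ Q rside (fun z => (rval z)^* ) (star_top Q) rmap_meet rmap_Sup.

Definition imap : locmap Q Q :=
  Locmap (star_top Q) (@star_meet _ Q) (@star_Sup _ Q).

End RightSided.
Arguments dmap {d} Q.
Arguments rmap {d} Q.
Arguments imap {d} Q.

(* The map [upsilon]. *)
Definition ups d (Q : involutiveQuantalFrameType d) (a : Q) : Q :=
  \Sup_(x, y | x * y^* <= a) (x `&` y).

HB.mixin Record isOpenQuantal d Q of InvolutiveQuantalFrame d Q := {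
  mul_meetr : forall a b c : Q,
    b * ((a * \top) `&` c) = (b `&` (\top * a^*)) * c;
  ups_rside : forall a : Q, ups a * \top <= ups a;
  Sup_mul_star_mul : forall a : Q, Sup [set x : Q | x * x^* * x <= a]%classic = a;
  meet_mull : forall a b c : Q,
    ((a * \top) `&` b) * c = (a * \top) `&` (b * c)
}.

#[short(type="openQuantalFrameType")]
HB.structure Definition OpenQuantalFrame d :=
  {Q of InvolutiveQuantalFrame d Q & isOpenQuantal d Q}.

Section LocalBisection.
Variables (d : Order.disp_t) (Q : openQuantalFrameType d).
Implicit Types a b c x y : Q.

Record local_bisection := LocalBisection {
  lb_dom : rside Q;
  lb_map : locmap (open_sub lb_dom) Q;
  lb_dmap : lcomp (dmap Q) lb_map = kmap lb_dom;
  lb_open : open_map (lcomp (rmap Q) lb_map);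
  lb_mono : regular_mono (lcomp (rmap Q) lb_map)
}.
Implicit Types s t : local_bisection.

(* [s_sigma^* (a)] as an element of [R(Q)]. *)
Definition sinv s a : rside Q := osval (linv (lb_map s) a).

(* [sigma . a] *)
Definition lact s a : Q :=
  \Sup_(x, y | x^* * y <= a) (rval (sinv s x) `&` y).

(* [a . sigma^-1] *)
Definition ract_inv a s : Q :=
  \Sup_(x, y | x * y <= a) (x `&` (rval (sinv s y))^* ).

Lemma lb_ext s t :
  lb_dom s = lb_dom t -> (forall a, sinv s a = sinv t a) -> s = t.
Proof.
case: s t => U f fd fo fm [V g gd go gm] /= UV; case: V / UV in g gd go gm *.
rewrite /sinv /= => fg.
have {}fg : f = g by apply: locmap_ext => a; apply: osval_inj.
by case: g / fg in gd go gm *; congr LocalBisection; apply: Prop_irrelevance.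
Qed.

Lemma sinv_le s x y : x <= y -> sinv s x <= sinv s y.
Proof.
by move=> /(linv_le (lb_map s)); rewrite -Order.le_val.
Qed.
Lemma sinv_dom s x : sinv s x <= lb_dom s.
Proof. exact: osvalP. Qed.
Lemma sinv_top s : sinv s \top = lb_dom s.
Proof. by rewrite /sinv linv_top. Qed.
Lemma sinv_meet s x y : sinv s (x `&` y) = sinv s x `&` sinv s y.
Proof. by rewrite /sinv linv_meet. Qed.
Lemma sinv_Sup s : preserves_Sup (sinv s).
Proof. by move=> A; rewrite /sinv linv_Sup /= image_comp. Qed.
Lemma sinv_rval s (z : rside Q) : sinv s (rval z) = z `&` lb_dom s.
Proof.
by have /(congr1 (fun f => osval (linv f z))) := lb_dmap s.
Qed.

Lemma le_mul_top a : a <= a * \top.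
Proof.
rewrite -[X in _ <= X]Sup_mul_star_mul; apply: Sup_ub => /=.
by rewrite -mulgA le_mul.
Qed.
Lemma le_top_mul a : a <= \top * a.
Proof. by rewrite -[a]starK le_star starM starK star_top le_mul_top. Qed.
Lemma mul_top_rside a : a * \top * \top <= a * \top.
Proof. by rewrite -mulgA le_mul. Qed.

Lemma sinv_le_mul_top s x : rval (sinv s x) <= x * \top.
Proof.
have := sinv_le s (le_mul_top x).
rewrite -[x * \top]/(rval (RSide (mul_top_rside x))) sinv_rval => h.
by have := le_trans h (leIl _ _); rewrite -Order.le_val.
Qed.

Lemma le_rval (z w : rside Q) : (rval z <= rval w) = (z <= w).
Proof. by rewrite -Order.le_val. Qed.

End LocalBisection.

Section Inverse.
Variables (d : Order.disp_t) (Q : openQuantalFrameType d).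
Implicit Types s t : local_bisection Q.

(* [t] is [(V, i o t')] where [r o s = k_V o alpha] with [alpha] an isomorphism
   and [t' = s o alpha^-1]. *)
Definition is_lbinv s t : Prop :=
  exists (alpha : locmap (open_sub (lb_dom s)) (open_sub (lb_dom t)))
         (beta : locmap (open_sub (lb_dom t)) (open_sub (lb_dom s))),
    [/\ lcomp alpha beta = lid _, lcomp beta alpha = lid _,
        lcomp (rmap Q) (lb_map s) = lcomp (kmap (lb_dom t)) alpha &
        lb_map t = lcomp (imap Q) (lcomp (lb_map s) beta)].

Lemma lbinv_exists s : exists t, is_lbinv s t.
Proof.
case: s => U s sd so sm; have [f_ [f_adj f_frob]] := so.
have f_surj := regular_mono_linv_surj f_adj f_frob sm.
have [f Ef] : exists f, f = lcomp (rmap Q) s by eexists.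
rewrite -Ef in f_adj f_frob f_surj.
have f_unit x : x <= linv f (f_ x) by rewrite f_surj.
have f_mono x y : x <= y -> f_ x <= f_ y.
  by move=> xy; apply/f_adj; apply: le_trans xy (f_unit y).
have f_V y : f_ (linv f y) = f_ \top `&` y by rewrite -f_frob meet1x.
pose V := f_ \top.
have a1 : linv f (osval (\top : open_sub V)) = \top.
  by apply/le_anti; rewrite lex1 f_unit.
have a2 (x y : open_sub V) : linv f (osval (x `&` y)) =
    linv f (osval x) `&` linv f (osval y).
  by rewrite osval_meet linv_meet.
have a3 : preserves_Sup (fun x : open_sub V => linv f (osval x)).
  by move=> A; rewrite /= linv_Sup image_comp.
pose alpha := Locmap a1 a2 a3 : locmap (open_sub U) (open_sub V).
have f_leV x : f_ x <= V by apply: f_mono; rewrite lex1.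
pose b (x : open_sub U) : open_sub V := OpenSub (f_leV x).
have b1 : b \top = \top by apply: osval_inj.
have b2 x y : b (x `&` y) = b x `&` b y.
  by apply: osval_inj; rewrite osval_meet /= -{1}[y]f_surj f_frob.
have b3 : preserves_Sup b.
  move=> A; apply: osval_inj; rewrite /= image_comp.
  apply/le_anti/andP; split.
    apply/f_adj; apply: Sup_le => x Ax; apply/f_adj.
    by apply: Sup_ub; exists x.
  by apply: Sup_le => _ [x Ax <-]; apply: f_mono; apply: Sup_ub.
pose beta := Locmap b1 b2 b3 : locmap (open_sub V) (open_sub U).
have ab x : b (linv f (osval x)) = x.
  by apply: osval_inj; rewrite /= f_V meet_r //; apply: osvalP.
have Ef' z : linv f z = linv s (rval z)^* by rewrite Ef.
have sdE z : linv s (rval z) = kmap_inv U z.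
  by have /(congr1 (fun f => linv f z)) := sd.
pose t := lcomp (imap Q) (lcomp s beta).
have td : lcomp (dmap Q) t = kmap V.
  apply: locmap_ext => z; apply: osval_inj.
  by rewrite /= -Ef' f_V meetC.
have tr z : linv (lcomp (rmap Q) t) z = b (kmap_inv U z).
  by rewrite /= starK sdE.
pose g_ (x : open_sub V) : rside Q := osval (linv f (osval x)).
have g_adj x z : g_ x <= z <-> x <= linv (lcomp (rmap Q) t) z.
  rewrite tr -[x in x <= b _]ab; split=> h.
    rewrite -Order.le_val /=; apply: f_mono.
    by rewrite -Order.le_val /= lexI h osvalP.
  have {}h : f_ (linv f (osval x)) <= f_ (kmap_inv U z).
    by rewrite -Order.le_val in h.
  move: h; rewrite f_adj f_surj => h.
  have {}h : g_ x <= z `&` U by rewrite -Order.le_val in h.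
  exact: le_trans h (leIl _ _).
have g_frob x z : g_ (x `&` linv (lcomp (rmap Q) t) z) = g_ x `&` z.
  rewrite tr /g_ osval_meet linv_meet f_surj osval_meet /= meetCA.
  by rewrite [X in _ `&` X = _]meet_l 1?meetC // osvalP.
have g_surj x : linv (lcomp (rmap Q) t) (g_ x) = x.
  rewrite tr -[RHS]ab; congr b; apply: osval_inj => /=.
  by rewrite meet_l // osvalP.
have t_open : open_map (lcomp (rmap Q) t) by exists g_.
have t_mono := regular_mono_open g_adj g_frob g_surj.
exists (LocalBisection td t_open t_mono), alpha, beta; split => //=.
- by apply: locmap_ext => x /=; rewrite ab.
- by apply: locmap_ext => x /=; rewrite f_surj.
- apply: locmap_ext => z; rewrite /= -Ef'.
  by rewrite linv_meet [linv f V]a1 meetx1.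
Qed.

Lemma is_lbinv_inj s t t' : is_lbinv s t -> is_lbinv s t' -> t = t'.
Proof.
case=> a [b [ab ba fa tE]] [a' [b' [ab' ba' fa' tE']]].
have abE z : linv b (linv a z) = z.
  by have /(congr1 (fun f => linv f z)) := ab.
have baE z : linv a (linv b z) = z.
  by have /(congr1 (fun f => linv f z)) := ba.
have abE' z : linv b' (linv a' z) = z.
  by have /(congr1 (fun f => linv f z)) := ab'.
have baE' z : linv a' (linv b' z) = z.
  by have /(congr1 (fun f => linv f z)) := ba'.
have aa z : linv a (kmap_inv _ z) = linv a' (kmap_inv _ z).
  by have /(congr1 (fun f => linv f z)) := etrans (esym fa) fa'.
have topV (V : rside Q) : kmap_inv V V = \top.
  by apply: osval_inj; rewrite /= meetxx.
have tt' : lb_dom t = lb_dom t'.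
  apply/le_anti/andP; split; [have e := aa (lb_dom t')|have e := aa (lb_dom t)].
    move: e; rewrite topV linv_top => /(congr1 (linv b)).
    rewrite abE linv_top => /(congr1 (@osval _ _ _)) /= e.
    by rewrite leEmeet meetC e.
  move: e; rewrite topV linv_top => /(congr1 (linv b')).
  rewrite abE' linv_top => /(congr1 (@osval _ _ _)) /= e.
  by rewrite leEmeet meetC -e.
have kK (V : rside Q) (x : open_sub V) : kmap_inv V (osval x) = x.
  by apply: osval_inj; rewrite /= meet_l // osvalP.
apply: lb_ext => // c; rewrite /sinv tE tE' /=.
set x := linv (lb_map s) _; rewrite -[in RHS](baE x); set y := linv b x.
by rewrite -[in RHS](kK _ y) aa abE' /= meet_l // -tt' osvalP.
Qed.

(* By [is_lbinv_inj] the choice is immaterial. *)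
Definition lbinv s : local_bisection Q := sval (cid (lbinv_exists s)).

Lemma lbinvP s : is_lbinv s (lbinv s).
Proof. exact: svalP (cid (lbinv_exists s)). Qed.

(* [a . sigma], that is [a . (sigma^-1)^-1] *)
Definition ract (a : Q) s : Q := ract_inv a (lbinv s).

End Inverse.

Section Product.
Variables (d : Order.disp_t) (Q : openQuantalFrameType d).
Implicit Types (s t : local_bisection Q) (a b x y : Q).

Section LbMul.
Variables (s t : local_bisection Q).

(* The data of [sigma tau]: the open [U] and the candidate inverse image, which
   is a frame homomorphism as soon as it preserves joins. *)
Definition lbmul_dom : rside Q := sinv s (rval (lb_dom t))^*.

Definition lbmul_inv a : open_sub (lb_dom s) :=
  \Sup_(x, y | x * y <= a) (linv (lb_map s) (x `&` (rval (sinv t y))^* )).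

Lemma lbmul_invE a : lbmul_inv a = linv (lb_map s) (ract_inv a t).
Proof.
rewrite /ract_inv linv_Sup; congr Sup; apply/seteqP; split.
  move=> _ [x [y [xy <-]]]; exists (x `&` (rval (sinv t y))^*) => //.
  by exists x, y.
by move=> _ [_ [x [y [xy <-]]] <-]; exists x, y.
Qed.

Lemma lbmul_inv_ub a x y :
  x * y <= a -> sinv s (x `&` (rval (sinv t y))^*) <= osval (lbmul_inv a).
Proof.
move=> xy; suff: linv (lb_map s) (x `&` (rval (sinv t y))^* ) <= lbmul_inv a.
  by rewrite -Order.le_val.
by apply: Sup_ub; exists x, y.
Qed.

Lemma lbmul_inv_least a (z : rside Q) :
  (forall x y, x * y <= a -> sinv s (x `&` (rval (sinv t y))^*) <= z) ->
  osval (lbmul_inv a) <= z.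
Proof.
move=> h; rewrite /lbmul_inv /=; apply: Sup_le => _ [_ [x [y [xy <-]]] <-].
exact: h.
Qed.

Lemma lbmul_inv_le a : osval (lbmul_inv a) <= lbmul_dom.
Proof.
apply: lbmul_inv_least => x y _; apply: sinv_le.
by apply: (le_trans (leIr _ _)); apply: star_le; rewrite le_rval sinv_dom.
Qed.

Lemma lbmul_inv_top : osval (lbmul_inv \top) = lbmul_dom.
Proof.
apply/le_anti; rewrite lbmul_inv_le /=.
have := @lbmul_inv_ub \top \top \top (lex1 _).
by rewrite meet1x sinv_top.
Qed.

Lemma lbmul_inv_meet a b : lbmul_inv (a `&` b) = lbmul_inv a `&` lbmul_inv b.
Proof.
apply/le_anti/andP; split.
  rewrite lexI; apply/andP; split; apply: Sup_le => _ [x [y [xy <-]]];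
    apply: Sup_ub; exists x, y; split=> //; apply: le_trans xy _;
    by rewrite ?leIl ?leIr.
rewrite Sup_meet; apply: Sup_le => _ [_ [_ [[[x [y [xy <-]]] [x' [y' [xy' <-]]]] ->]]].
rewrite -linv_meet meetACA -star_meet -rval_meet -sinv_meet.
apply: Sup_ub; exists (x `&` x'), (y `&` y'); split=> //.
rewrite lexI; apply/andP; split.
  by apply: le_trans xy; apply: le_mul; rewrite ?leIl.
by apply: le_trans xy'; apply: le_mul; rewrite ?leIr.
Qed.

Lemma lbmul_inv_rval (z : rside Q) :
  osval (lbmul_inv (rval z)) = z `&` lbmul_dom.
Proof.
apply/le_anti/andP; split.
  rewrite lexI lbmul_inv_le andbT; apply: lbmul_inv_least => x y xy.
  suff h : x `&` (rval (sinv t y))^* <= rval z.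
    by have := sinv_le s h; rewrite sinv_rval => /le_trans; apply; exact: leIl.
  apply: (le_trans (y := x `&` (\top * y^*))).
    apply: leI2 => //; apply: le_trans (star_le (sinv_le_mul_top t y)) _.
    by rewrite starM star_top.
  apply: (le_trans (le_mul_top _)); rewrite -mul_meetr meetx1 mulgA.
  by apply: le_trans (rvalP z); apply: le_mul.
have := @lbmul_inv_ub (rval z) (rval z) \top (rvalP z).
rewrite sinv_top sinv_meet sinv_rval; apply: le_trans.
rewrite /lbmul_dom -meetA leI2 // lexI lexx andbT.
exact: sinv_dom.
Qed.

Lemma lbmul_inv_star (z : rside Q) :
  osval (lbmul_inv (rval z)^*) = sinv s (rval (sinv t (rval z)^*))^*.
Proof.
apply/le_anti/andP; split.
  apply: lbmul_inv_least => x y xy; apply: sinv_le; rewrite -le_star star_meet starK.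
  have xR : x^* * \top * \top <= x^* * \top by exact: mul_top_rside.
  apply: (le_trans (y := rval (sinv t ((x^* * \top) `&` y)))).
    rewrite sinv_meet -[x^* * \top]/(rval (RSide xR)) sinv_rval !rval_meet /=.
    rewrite -meetA leI2 // ?le_mul_top // lexI lexx andbT.
    by rewrite le_rval sinv_dom.
  rewrite le_rval; apply: sinv_le; apply: le_trans (le_top_mul _) _.
  rewrite mul_meetr starK meet1x -mulgA; apply: (le_trans (le_mul (lexx _) xy)).
  by rewrite -le_star starM starK star_top; exact: rvalP.
have h : \top * (rval z)^* <= (rval z)^*.
  by rewrite -le_star starM starK star_top; exact: rvalP.
by have := lbmul_inv_ub h; rewrite meet1x.
Qed.

Hypothesis lbmul_preserves_Sup : preserves_Sup lbmul_inv.

Let f a : open_sub lbmul_dom := OpenSub (lbmul_inv_le a).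
Fact lbmul_top : f \top = \top.
Proof. by apply: osval_inj; exact: lbmul_inv_top. Qed.
Fact lbmul_meet a b : f (a `&` b) = f a `&` f b.
Proof. by apply: osval_inj; exact: (congr1 (@osval _ _ _) (lbmul_inv_meet a b)). Qed.
Fact lbmul_Sup : preserves_Sup f.
Proof.
move=> A; apply: osval_inj.
by rewrite [LHS](congr1 (@osval _ _ _) (lbmul_preserves_Sup A)) /= !image_comp.
Qed.
Definition lbmul_map : locmap (open_sub lbmul_dom) Q :=
  Locmap lbmul_top lbmul_meet lbmul_Sup.

Fact lbmul_dmap : lcomp (dmap Q) lbmul_map = kmap lbmul_dom.
Proof. by apply: locmap_ext => z; apply: osval_inj; exact: lbmul_inv_rval. Qed.

Fact lbmul_rmap :
  open_map (lcomp (rmap Q) lbmul_map) /\ regular_mono (lcomp (rmap Q) lbmul_map).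
Proof.
have [g_ [g_adj g_frob]] := lb_open s.
have g_surj := regular_mono_linv_surj g_adj g_frob (lb_mono s).
have [h_ [h_adj h_frob]] := lb_open t.
have h_surj := regular_mono_linv_surj h_adj h_frob (lb_mono t).
set g := lcomp (rmap Q) (lb_map s) in g_adj g_frob g_surj *.
set h := lcomp (rmap Q) (lb_map t) in h_adj h_frob h_surj *.
have gE z : sinv s (rval z)^* = osval (linv g z) by [].
have hE z : sinv t (rval z)^* = osval (linv h z) by [].
pose U := lb_dom s; pose V := lb_dom t.
have domU : lbmul_dom <= U by exact: sinv_dom.
pose lift (w : open_sub lbmul_dom) : open_sub U :=
  OpenSub (le_trans (osvalP w) domU).
have liftV w : g_ (lift w) <= V.
  by apply/g_adj; rewrite -Order.le_val /= -gE osvalP.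
pose f_ w := h_ (OpenSub (liftV w)).
have fE z : osval (linv (lcomp (rmap Q) lbmul_map) z) =
    osval (linv g (osval (linv h z))).
  by rewrite -gE -hE -lbmul_inv_star.
have f_adj w z : f_ w <= z <-> w <= linv (lcomp (rmap Q) lbmul_map) z.
  rewrite h_adj -[_ <= linv h z]le_osval -[w <= _]le_osval fE.
  by rewrite [osval (OpenSub _)]/= g_adj -[_ <= linv g _]le_osval.
have f_frob w z : f_ (w `&` linv (lcomp (rmap Q) lbmul_map) z) = f_ w `&` z.
  rewrite /f_ -h_frob; congr h_; apply: osval_inj; rewrite osval_meet.
  transitivity (g_ (lift w) `&` osval (linv h z)) => //.
  transitivity (g_ (lift (w `&` linv (lcomp (rmap Q) lbmul_map) z))) => //.
  rewrite -g_frob; congr g_; apply: osval_inj.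
  by rewrite osval_meet [RHS]osval_meet; congr (_ `&` _); exact: fE.
have f_surj w : linv (lcomp (rmap Q) lbmul_map) (f_ w) = w.
  apply: osval_inj; rewrite fE /f_ h_surj.
  exact: (congr1 (@osval _ _ _) (g_surj (lift w))).
split; first by exists f_.
exact: regular_mono_open f_adj f_frob f_surj.
Qed.

Definition lbmul : local_bisection Q :=
  LocalBisection lbmul_dmap lbmul_rmap.1 lbmul_rmap.2.

End LbMul.

Section LbUnit.
Hypothesis ups_preserves_Sup : preserves_Sup (@ups d Q).

Lemma ups_meet a b : ups (a `&` b) = ups a `&` ups b.
Proof.
apply/le_anti/andP; split.
  rewrite lexI; apply/andP; split; apply: Sup_le => _ [x [y [xy <-]]];
    apply: Sup_ub; exists x, y; split=> //; apply: le_trans xy _;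
    by rewrite ?leIl ?leIr.
rewrite Sup_meet; apply: Sup_le => _ [_ [_ [[[x [y [xy <-]]] [x' [y' [xy' <-]]]] ->]]].
rewrite meetACA; apply: Sup_ub; exists (x `&` x'), (y `&` y'); split=> //.
rewrite star_meet lexI; apply/andP; split.
  by apply: le_trans xy; apply: le_mul; rewrite ?leIl.
by apply: le_trans xy'; apply: le_mul; rewrite ?leIr.
Qed.

Lemma ups_top : ups (\top : Q) = \top.
Proof.
apply/le_anti; rewrite lex1 /=; apply: Sup_ub; exists \top, \top.
by rewrite meetxx lex1.
Qed.

Lemma ups_star a : ups a^* = ups a.
Proof.
apply/le_anti/andP; split; apply: Sup_le => _ [x [y [xy <-]]];
  rewrite meetC; apply: Sup_ub; exists y, x; split=> //.
  by rewrite -[a]starK -le_star starM starK.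
by rewrite -le_star starM starK.
Qed.

Lemma ups_rval (z : rside Q) : ups (rval z) = rval z.
Proof.
apply/le_anti/andP; split.
  apply: Sup_le => _ [x [y [xy <-]]].
  apply: (le_trans (y := x `&` (\top * y^*^*))).
    by rewrite starK leI2 // le_top_mul.
  apply: (le_trans (le_mul_top _)); rewrite -mul_meetr meetx1 mulgA.
  by apply: le_trans (rvalP z); apply: le_mul.
apply: Sup_ub; exists (rval z), \top.
by rewrite star_top meetx1; split=> //; exact: rvalP.
Qed.

Definition upsR a : rside Q := RSide (ups_rside a).
Let f a : open_sub (\top : rside Q) := OpenSub (lex1 (upsR a)).
Fact lbunit_top : f \top = \top.
Proof. by apply: osval_inj; apply: rval_inj; rewrite /= ups_top. Qed.
Fact lbunit_meet a b : f (a `&` b) = f a `&` f b.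
Proof. by apply: osval_inj; apply: rval_inj; exact: ups_meet. Qed.
Fact lbunit_Sup : preserves_Sup f.
Proof.
move=> A; apply: osval_inj; apply: rval_inj.
by rewrite /= ups_preserves_Sup /= !image_comp.
Qed.
Definition lbunit_map : locmap (open_sub (\top : rside Q)) Q :=
  Locmap lbunit_top lbunit_meet lbunit_Sup.

Fact lbunit_dmap : lcomp (dmap Q) lbunit_map = kmap \top.
Proof.
apply: locmap_ext => z; apply: osval_inj; apply: rval_inj.
by rewrite /= meetx1 ups_rval.
Qed.
Fact lbunit_rmap : lcomp (rmap Q) lbunit_map = kmap \top.
Proof.
apply: locmap_ext => z; apply: osval_inj; apply: rval_inj.
by rewrite /= meetx1 ups_star ups_rval.
Qed.
Fact lbunit_open : open_map (lcomp (rmap Q) lbunit_map).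
Proof. by rewrite lbunit_rmap; exact: kmap_open. Qed.
Fact lbunit_mono : regular_mono (lcomp (rmap Q) lbunit_map).
Proof. by rewrite lbunit_rmap; exact: kmap_regular_mono. Qed.

(* [epsilon = (1, u)] with [u^* = upsilon]. *)
Definition lbunit : local_bisection Q :=
  LocalBisection lbunit_dmap lbunit_open lbunit_mono.

Lemma lbinv_unit : lbinv lbunit = lbunit.
Proof.
apply: is_lbinv_inj (lbinvP _) _; exists (lid _), (lid _).
split; try exact: locmap_ext.
  by rewrite [LHS]lbunit_rmap; exact: locmap_ext.
apply: locmap_ext => a; apply: osval_inj; apply: rval_inj.
exact: esym (ups_star a).
Qed.

End LbUnit.

End Product.

Section WeaklyMultiplicative.
Variables (d : Order.disp_t) (Q : openQuantalFrameType d).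
Implicit Types s t v : local_bisection Q.

Lemma ract_inv_star (a : Q) s : ract_inv a s = (lact s a^*)^*.
Proof.
rewrite star_Sup; congr Sup; apply/seteqP; split.
  move=> _ [x [y [xy <-]]]; exists (rval (sinv s y) `&` x^*).
    by exists y, x^*; split=> //; rewrite -starM star_le.
  by rewrite star_meet starK meetC.
move=> _ [_ [x [y [xy <-]]] <-]; exists y^*, x.
split; first by rewrite -[a]starK -le_star starM starK.
by rewrite star_meet meetC.
Qed.

Hypothesis lact_preserves_Sup : forall s, preserves_Sup (lact s).

Lemma lbmul_inv_preserves_Sup s t : preserves_Sup (lbmul_inv s t).
Proof.
move=> A; rewrite lbmul_invE ract_inv_star [(Sup A)^*]star_Sup lact_preserves_Sup star_Sup.
rewrite linv_Sup !image_comp; congr Sup; apply: eq_imagel => a _ /=.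
by rewrite lbmul_invE ract_inv_star.
Qed.

Definition lb_prod s t : local_bisection Q :=
  lbmul (lbmul_inv_preserves_Sup s t).

End WeaklyMultiplicative.

Record weakly_multiplicative d (Q : openQuantalFrameType d) : Prop := {
  wm_ups : preserves_Sup (@ups d Q);
  wm_lact : forall s : local_bisection Q, preserves_Sup (lact s);
  wm_assoc : forall s t v : local_bisection Q,
    lb_prod wm_lact (lb_prod wm_lact s t) v =
    lb_prod wm_lact s (lb_prod wm_lact t v)
}.

Section InverseSemigroup.
Variables (S : Type) (mul : S -> S -> S) (inv : S -> S).

Record is_inverse_semigroup : Prop := {
  is_assoc : associative mul;
  is_mulVr : forall a, mul (mul a (inv a)) a = a;
  is_mulVl : forall a, mul (mul (inv a) a) (inv a) = inv a;
  is_inv_unique : forall a b,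
    mul (mul a b) a = a -> mul (mul b a) b = b -> b = inv a
}.

Definition idempotent_elt (e : S) : Prop := mul e e = e.

Definition natural_le (a b : S) : Prop :=
  exists2 e, idempotent_elt e & a = mul e b.

Definition compatible (a b : S) : Prop :=
  idempotent_elt (mul a (inv b)) /\ idempotent_elt (mul (inv a) b).

Definition pairwise_compatible (A : set S) : Prop :=
  forall a b, A a -> A b -> compatible a b.

Definition natural_join (A : set S) (j : S) : Prop :=
  (forall a, A a -> natural_le a j) /\
  (forall b, (forall a, A a -> natural_le a b) -> natural_le j b).

Record is_complete_pseudogroup : Prop := {
  cp_inverse_semigroup : is_inverse_semigroup;
  cp_complete : forall A : set S, pairwise_compatible A ->
    exists j, natural_join A j;
  cp_distributive : forall (A : set S) (j b : S),
    pairwise_compatible A -> natural_join A j ->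
    natural_join [set mul b a | a in A]%classic (mul b j) /\
    natural_join [set mul a b | a in A]%classic (mul j b)
}.

End InverseSemigroup.

(* Main.v *)
Require Import Defs.
From mathcomp Require Import all_boot all_order.
From mathcomp Require Import boolp classical_sets.
Local Open Scope group_scope.
Local Open Scope order_scope.

Set Implicit Arguments.
Unset Strict Implicit.
Unset Printing Implicit Defensive.
Import Order.TTheory.

(** A local bisection [s] is determined by the map [sinv s : Q -> R(Q)], so the
whole theorem is a computation with these maps.  Their behaviour on products
with idempotents and inverses is simple enough to carry everything.  Below, [S_s]
is [sinv s] and [T_s] is [sinv (lbinv s)].

For [z] in [R(Q)] let [lbid z] be the restriction of the unit to [z]; its map
is [a |-> z /\ ups a].  The axiom that [x x^* x <= a] implies [x <= a] gives
[ups x /\ y <= a] whenever [x^* y <= a], and the join form of the axiom gives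
enough such pairs to recover [a]; hence [lact (lbid z) a = z /\ a]
([lact_lbid]).  It follows that multiplying by [lbid z] on either side is
restriction ([sinv_lbid_mul], [sinv_mul_lbid]), and the same kind of computation
shows that [s s^-1 = lbid (lb_dom s)] ([mulV]).  With associativity, which is
assumed, this makes the semigroup regular.

Every idempotent is of the form [lbid z] ([idempotentE]): if [s s = s] then
[s^-1 = (s^-1 s) (s s^-1)] is a product of two such elements, hence is one
itself, and so is its inverse [s].  As [z |-> lbid z] turns meets into products,
idempotents commute, inverses are unique, the semilattice of idempotents is
[R(Q)], and the natural order is restriction ([natural_leP]).

For completeness, compatibility of [s] and [t] makes their maps agree on the
overlap of their domains, and likewise for their inverses.
The pointwise join of the maps of a compatible family therefore preserves finite
meets, and is invertible with inverse the pointwise join of the maps of the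
inverses ([exists_lb_union]).  Finally, an upper bound of a family whose domain
is covered by the domains of the family is its join ([natural_joinP]), which
reduces distributivity to comparing domains. *)

(** * Local bisections as pairs of mutually inverse maps *)

Section Bisections.
Variables (d : Order.disp_t) (Q : openQuantalFrameType d).
Implicit Types (s t : local_bisection Q) (a b x y : Q) (z w : rside Q).

Lemma lb_ext_sinv s t : (forall a, sinv s a = sinv t a) -> s = t.
Proof. by move=> st; apply: lb_ext; rewrite // -!sinv_top st. Qed.

Lemma sinv_Sup_le s (A : set Q) z :
  (forall x, A x -> sinv s x <= z) -> sinv s (Sup A) <= z.
Proof. by move=> h; rewrite sinv_Sup; apply: Sup_le => _ [x Ax <-]; apply: h. Qed.

Lemma le_cube x a : x * x^* * x <= a -> x <= a.
Proof. by move=> h; rewrite -[a]Sup_mul_star_mul; apply: Sup_ub. Qed.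

(** The conditions that [S = sinv s] and [T = sinv (lbinv s)] satisfy for a
local bisection [s]: the first three make [S] the inverse image of a section over
[S \top] of the map from [Q] to [R(Q)] whose inverse image is [rval].  Stating them for
bare maps lets one build a local bisection without handling its open
sublocales. *)
Record cross_section (S T : Q -> rside Q) : Prop := {
  cs_meet : forall a b, S (a `&` b) = S a `&` S b;
  cs_Sup : preserves_Sup S;
  cs_rval : forall z, S (rval z) = z `&` S \top;
  cs_star : forall a, S (rval (T a))^* = S a^*
}.

(** The point is that [r] composed with the section given by [S] is an open
regular monomorphism: its direct image is [v |-> T v^*]. *)
Lemma lb_of_cross_section S T : cross_section S T -> cross_section T S ->
  exists s, forall a, sinv s a = S a.
Proof.
move=> [SI SS Sr ST] [TI TS Tr TST].
have Sle a b : a <= b -> S a <= S b by move/meet_l => e; rewrite leEmeet -SI e.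
have Tle a b : a <= b -> T a <= T b by move/meet_l => e; rewrite leEmeet -TI e.
pose U := S \top.
have SU a : S a <= U by apply: Sle; exact: lex1.
pose f a : open_sub U := OpenSub (SU a).
have f1 : f \top = \top by exact: osval_inj.
have f2 a b : f (a `&` b) = f a `&` f b by apply: osval_inj; exact: SI.
have f3 : preserves_Sup f.
  by move=> A; apply: osval_inj; rewrite /= SS image_comp.
pose F : locmap (open_sub U) Q := Locmap f1 f2 f3.
have Fd : lcomp (dmap Q) F = kmap U.
  by apply: locmap_ext => z; apply: osval_inj; exact: Sr.
pose g (v : open_sub U) : rside Q := T (rval (osval v))^*.
have adj v w : g v <= w <-> v <= linv (lcomp (rmap Q) F) w.
  rewrite -[v <= _]le_osval /g /=; split=> h.
    have {}h : S (rval (T (rval (osval v))^*))^* <= S (rval w)^*.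
      by apply: Sle; apply: star_le; rewrite le_rval.
    apply: le_trans h; rewrite ST starK Sr lexI lexx; exact: osvalP.
  have {}h : T (rval (osval v))^* <= T (rval (S (rval w)^*))^*.
    by apply: Tle; apply: star_le; rewrite le_rval.
  by apply: (le_trans h); rewrite TST starK Tr leIl.
have frob v w : g (v `&` linv (lcomp (rmap Q) F) w) = g v `&` w.
  rewrite /g osval_meet rval_meet star_meet TI TST starK Tr.
  by rewrite (meetC w) meetA; congr (_ `&` _); apply: meet_l; apply: Tle; exact: lex1.
have surj v : linv (lcomp (rmap Q) F) (g v) = v.
  apply: osval_inj; rewrite /= /g ST starK Sr; apply: meet_l; exact: osvalP.
have Fo : open_map (lcomp (rmap Q) F) by exists g.
by exists (LocalBisection Fd Fo (regular_mono_open adj frob surj)).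
Qed.

(** In [is_lbinv] the isomorphism [alpha] of domains has inverse image
[v |-> sinv s v^*], which is why it cancels against [sinv (lbinv s)]. *)
Lemma sinv_lbinv s a : sinv s (rval (sinv (lbinv s) a))^* = sinv s a^*.
Proof.
have [alpha [beta [_ ba fa tE]]] := lbinvP s.
have baE v : linv alpha (linv beta v) = v.
  by have /(congr1 (fun f => linv f v)) := ba.
have faE v : linv (lb_map s) (rval v)^* = linv alpha (kmap_inv _ v).
  by have /(congr1 (fun f => linv f v)) := fa.
rewrite /sinv faE; congr osval; rewrite tE /=.
set v := linv beta _.
have -> : kmap_inv (lb_dom (lbinv s)) (osval v) = v.
  by apply: osval_inj; rewrite /= meet_l // osvalP.
by rewrite baE.
Qed.

Lemma lbinv_sinv s a : sinv (lbinv s) (rval (sinv s a))^* = sinv (lbinv s) a^*.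
Proof.
have [alpha [beta [_ _ _ tE]]] := lbinvP s.
rewrite /sinv tE /= !starK; congr (osval (linv beta _)).
apply: osval_inj; rewrite -[LHS]/(sinv s (rval (sinv s a))) sinv_rval.
by apply: meet_l; exact: sinv_dom.
Qed.

Lemma cross_section_sinv s : cross_section (sinv s) (sinv (lbinv s)).
Proof.
split; [exact: sinv_meet|exact: sinv_Sup| |exact: sinv_lbinv].
by move=> z; rewrite sinv_rval sinv_top.
Qed.

Lemma cross_section_lbinv s : cross_section (sinv (lbinv s)) (sinv s).
Proof.
split; [exact: sinv_meet|exact: sinv_Sup| |exact: lbinv_sinv].
by move=> z; rewrite sinv_rval sinv_top.
Qed.

(** Two inverses [T1], [T2] of the same [S] satisfy
[T1 a = T1 ((S b)^* ) = T1 (T2 a) <= T2 a] for [b = a^*], where the middle step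
uses [S b = S ((T2 a)^* )] and the last one that [T1] restricts to [z |-> z /\ T1 \top]
on [R(Q)]. *)
Lemma lbinv_eq s t : cross_section (sinv s) (sinv t) ->
  cross_section (sinv t) (sinv s) -> lbinv s = t.
Proof.
have half t1 t2 a : cross_section (sinv s) (sinv t2) ->
    cross_section (sinv t1) (sinv s) -> sinv t1 a <= sinv t2 a.
  move=> c2 c1.
  rewrite -[a in sinv t1 a]starK -(cs_star c1) -(cs_star c2) (cs_star c1) starK.
  by rewrite sinv_rval leIl.
have ci := cross_section_sinv s; have ic := cross_section_lbinv s.
move=> st ts; apply: lb_ext_sinv => a.
by apply/le_anti; rewrite !half.
Qed.

Lemma lbinvK s : lbinv (lbinv s) = s.
Proof.
apply: lbinv_eq; [exact: cross_section_lbinv|exact: cross_section_sinv].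
Qed.

Lemma le_ups x y : x `&` y <= ups (x * y^*).
Proof. by apply: Sup_ub; exists x, y. Qed.

Lemma le_ups_cube x : x <= ups (x * x^*).
Proof. by have := le_ups x x; rewrite meetxx. Qed.

(** This is [lact] of the unit being below the identity.  For [p q^* <= x] the
element [w = p /\ q /\ y] satisfies [w w^* w <= q p^* y <= x^* y <= a]. *)
Lemma ups_meet_le a x y : x^* * y <= a -> ups x `&` y <= a.
Proof.
move=> xya; rewrite meetC meet_Sup; apply: Sup_le => _ [_ [p [q [pq <-]]] <-].
apply: le_cube; apply: le_trans xya.
apply: le_mul; last exact: leIl.
apply: (@le_trans _ _ (q * p^*)); last by rewrite -le_star starM starK.
apply: le_mul; last apply: star_le; apply: le_trans (leIr _ _) _;
  by rewrite ?leIl ?leIr.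
Qed.

Lemma ups_meet_rval_star x z : ups (x `&` (rval z)^*) = ups x `&` rval z.
Proof. by rewrite ups_meet ups_star ups_rval. Qed.

(** * Unions of compatible families *)

Section Joins.
Variable A : set (local_bisection Q).
Hypothesis agree : forall s t a, A s -> A t -> sinv t a `&` lb_dom s <= sinv s a.
Hypothesis agreeV : forall s t a, A s -> A t ->
  sinv (lbinv t) a `&` lb_dom (lbinv s) <= sinv (lbinv s) a.

(** Agreement on overlaps makes the join of the maps preserve binary meets, since
[S_s a /\ S_t b] lies below both domains.  That the joins for [s] and for [s^-1]
are mutually inverse uses agreement of the inverses: the cross terms
[S_s ((T_t a)^* )] are dominated by the diagonal term [S_s ((T_s a)^* )]. *)
Lemma exists_lb_union : exists j, forall a, sinv j a = Sup [set sinv s a | s in A]%classic.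
Proof.
pose G (k : local_bisection Q -> local_bisection Q) a : rside Q :=
  Sup [set sinv (k s) a | s in A]%classic.
(* The two halves are symmetric, so they are proved at once: [k] and [l] stand
   for the identity and inversion, in either order. *)
have cross (k l : local_bisection Q -> local_bisection Q) :
    (forall s t a, A s -> A t -> sinv (k t) a `&` lb_dom (k s) <= sinv (k s) a) ->
    (forall s t a, A s -> A t -> sinv (l t) a `&` lb_dom (l s) <= sinv (l s) a) ->
    (forall s, cross_section (sinv (k s)) (sinv (l s))) ->
    cross_section (G k) (G l).
  move=> kA lA kl.
  have Gub m s a : A s -> sinv (m s) a <= G m a by move=> As; apply: Sup_ub; exists s.
  have Gle m a b : a <= b -> G m a <= G m b.
    move=> ab; apply: Sup_le => _ [s As <-].
    exact: le_trans (sinv_le _ ab) (Gub m s b As).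
  split=> [a b|B|z|a]; apply/le_anti/andP; split.
  - by rewrite lexI !Gle // ?leIl ?leIr.
  - rewrite Sup_meet; apply: Sup_le => _ [_ [_ [[[s As <-] [t At <-]] ->]]].
    apply: le_trans (Gub k t _ At); rewrite sinv_meet lexI leIr andbT.
    apply: le_trans (kA t s a At As); rewrite leI2 //; exact: sinv_dom.
  - apply: Sup_le => _ [s As <-]; apply: sinv_Sup_le => x Bx.
    by apply: le_trans (Gub k s _ As) _; apply: Sup_ub; exists x.
  - by apply: Sup_le => _ [x Bx <-]; apply: Gle; exact: Sup_ub.
  - rewrite lexI Gle ?lex1 // andbT; apply: Sup_le => _ [s As <-].
    by rewrite sinv_rval leIl.
  - rewrite meet_Sup; apply: Sup_le => _ [_ [s As <-] <-].
    by rewrite sinv_top -sinv_rval; exact: Gub.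
  - apply: Sup_le => _ [s As <-]; apply: le_trans (Gub k s _ As).
    have -> : (rval (G l a))^* =
        Sup [set (rval (sinv (l t) a))^* | t in A]%classic.
      by rewrite (@rmap_Sup _ Q) !image_comp.
    apply: sinv_Sup_le => _ [t At <-].
    rewrite -(cs_star (kl s)) sinv_rval -(cs_star (kl s) a).
    by apply: sinv_le; apply: star_le; rewrite le_rval lA.
  - apply: Sup_le => _ [s As <-]; rewrite -(cs_star (kl s)).
    apply: le_trans (Gub k s _ As); apply: sinv_le; apply: star_le.
    by rewrite le_rval Gub.
apply: (@lb_of_cross_section (G id) (G (@lbinv d Q))); apply: cross => //.
- exact: cross_section_sinv.
- exact: cross_section_lbinv.
Qed.

End Joins.

(** * Restrictions of the unit *)

Section Identities.
Hypothesis ups_preserves_Sup : preserves_Sup (@ups d Q).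

Lemma upsR_preserves_Sup : preserves_Sup (@upsR d Q).
Proof. by move=> A; apply: rval_inj; rewrite /= ups_preserves_Sup image_comp. Qed.

Lemma cross_section_ups z :
  cross_section (fun a => z `&` upsR a) (fun a => z `&` upsR a).
Proof.
have upsRI a b : upsR (a `&` b) = upsR a `&` upsR b :> rside Q.
  by apply: rval_inj; exact: ups_meet.
have upsRr w : upsR (rval w) = w by apply: rval_inj; exact: ups_rval.
have upsR1 : upsR \top = \top :> rside Q by apply: rval_inj; exact: ups_top.
have upsRs a : upsR a^* = upsR a by apply: rval_inj; exact: ups_star.
split=> [a b|A|w|a].
- by rewrite /= upsRI meetACA meetxx.
- by rewrite /= upsR_preserves_Sup meet_Sup image_comp.
- by rewrite /= upsRr upsR1 meetx1 meetC.
- rewrite -[LHS]/(z `&` upsR (rval (z `&` upsR a))^*).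
  by rewrite upsRs upsRr meetA meetxx upsRs.
Qed.

Lemma exists_lbid z : exists e, forall a, sinv e a = z `&` upsR a.
Proof. exact: (lb_of_cross_section (cross_section_ups z) (cross_section_ups z)). Qed.

Definition lbid z : local_bisection Q := sval (cid (exists_lbid z)).

Lemma sinv_lbid z a : sinv (lbid z) a = z `&` upsR a.
Proof. exact: svalP (cid (exists_lbid z)) a. Qed.

Lemma cross_section_lbid z : cross_section (sinv (lbid z)) (sinv (lbid z)).
Proof. by rewrite (funext (sinv_lbid z)); exact: cross_section_ups. Qed.

End Identities.
End Bisections.

(** * Products with restrictions of the unit *)

Section Pseudogroup.
Variables (d : Order.disp_t) (Q : openQuantalFrameType d).
Variable W : weakly_multiplicative Q.
Implicit Types (s t : local_bisection Q) (a b x y : Q) (z w : rside Q).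

Local Notation mul := (lb_prod (wm_lact W)).
Local Notation inv := (@lbinv d Q).
Local Notation id_ := (lbid (wm_ups W)).

Lemma sinv_mul s t a : sinv (mul s t) a = sinv s (ract_inv a t).
Proof. by rewrite -[LHS]/(osval (lbmul_inv s t a)) lbmul_invE. Qed.

Lemma dom_mul s t : lb_dom (mul s t) = sinv s (rval (lb_dom t))^*.
Proof. by []. Qed.

Lemma dom_lbid z : lb_dom (id_ z) = z.
Proof.
rewrite -sinv_top sinv_lbid; apply: rval_inj.
by rewrite rval_meet /= ups_top meetx1.
Qed.

Lemma lbid_unit : id_ \top = lbunit (wm_ups W).
Proof. by apply: lb_ext_sinv => a; rewrite sinv_lbid meet1x. Qed.

Lemma lbinv_lbid z : inv (id_ z) = id_ z.
Proof. by apply: lbinv_eq; exact: cross_section_lbid. Qed.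

(** The join of the [x] with [x x^* x <= a] is [a], and each such [x] is reached by
the pair [(x x^* , x)] because [x <= ups (x x^* )]. *)
Lemma lact_lbid z a : lact (id_ z) a = rval z `&` a.
Proof.
apply/le_anti/andP; split.
  apply: Sup_le => _ [x [y [xy <-]]]; rewrite sinv_lbid rval_meet -meetA.
  by rewrite leI2 // ups_meet_le.
rewrite -[a in _ `&` a]Sup_mul_star_mul meet_Sup; apply: Sup_le => _ [x xa <-].
apply: (@le_trans _ _ (rval (sinv (id_ z) (x * x^*)) `&` x)).
  by rewrite sinv_lbid rval_meet -meetA leI2 // lexI le_ups_cube lexx.
by apply: Sup_ub; exists (x * x^*), x; split=> //; rewrite starM starK.
Qed.

Lemma ract_inv_lbid z a : ract_inv a (id_ z) = a `&` (rval z)^*.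
Proof. by rewrite ract_inv_star lact_lbid star_meet starK meetC. Qed.

Lemma sinv_mul_lbid s z a : sinv (mul s (id_ z)) a = sinv s a `&` sinv s (rval z)^*.
Proof. by rewrite sinv_mul ract_inv_lbid sinv_meet. Qed.

(** This is the left unit law [eps t = t] written out: [ups] turns the summand
[x /\ (S_t y)^* ] into [ups x /\ S_t y], and that is [S_t (ups x /\ y)] because
[S_t] agrees with [z |-> z /\ lb_dom t] on [R(Q)]. *)
Lemma upsR_ract_inv t a : upsR (ract_inv a t) = sinv t a.
Proof.
have upsRS := upsR_preserves_Sup (wm_ups W).
have sups x : sinv t (ups x) <= upsR x.
  by rewrite -[ups x]/(rval (upsR x)) sinv_rval leIl.
have upsE x y : upsR (x `&` (rval (sinv t y))^*) = upsR x `&` sinv t y.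
  by apply: rval_inj; exact: ups_meet_rval_star.
apply/le_anti/andP; split.
  rewrite upsRS; apply: Sup_le => _ [_ [x [y [xy <-]]] <-]; rewrite upsE.
  apply: (@le_trans _ _ (sinv t (ups x `&` y))).
    rewrite sinv_meet -[ups x]/(rval (upsR x)) sinv_rval -meetA leI2 //.
    by rewrite lexI sinv_dom lexx.
  by apply: sinv_le; rewrite -ups_star; apply: ups_meet_le; rewrite starK.
rewrite -[a in sinv t a]Sup_mul_star_mul; apply: sinv_Sup_le => x xa.
apply: (@le_trans _ _ (upsR (x * x^*) `&` sinv t x)).
  by rewrite lexI lexx andbT; apply: le_trans (sups _); apply: sinv_le; exact: le_ups_cube.
rewrite -upsE upsRS; apply: Sup_ub; exists (x * x^* `&` (rval (sinv t x))^*) => //.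
by exists (x * x^*), x.
Qed.

Lemma sinv_lbid_mul z t a : sinv (mul (id_ z) t) a = z `&` sinv t a.
Proof. by rewrite sinv_mul sinv_lbid upsR_ract_inv. Qed.

Lemma lbid_meet z w : id_ (z `&` w) = mul (id_ z) (id_ w).
Proof. by apply: lb_ext_sinv => a; rewrite sinv_lbid_mul !sinv_lbid meetA. Qed.

(** [S_s] absorbs its own inverse, so the summand [S_s (x /\ (T_s y)^* )] becomes
[S_s (x /\ y^* )]; these join up to [S_s (ups a) = ups a /\ lb_dom s]. *)
Lemma mulV s : mul s (inv s) = id_ (lb_dom s).
Proof.
apply: lb_ext_sinv => a; rewrite sinv_lbid meetC -sinv_rval.
apply/le_anti/andP; split.
  apply: lbmul_inv_least => x y xy; rewrite sinv_meet sinv_lbinv -sinv_meet.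
  by apply: sinv_le; apply: Sup_ub; exists x, y^*; rewrite starK.
apply: sinv_Sup_le => _ [x [y [xy <-]]].
by rewrite sinv_meet -[y]starK -sinv_lbinv -sinv_meet; exact: lbmul_inv_ub.
Qed.

Lemma Vmul s : mul (inv s) s = id_ (lb_dom (inv s)).
Proof. by rewrite -{2}[s]lbinvK mulV. Qed.

(** * The inverse semigroup *)

Lemma mulA : associative mul.
Proof. by move=> s t v; rewrite (wm_assoc W). Qed.

Lemma lbid_dom_mul s : mul (id_ (lb_dom s)) s = s.
Proof. by apply: lb_ext_sinv => a; rewrite sinv_lbid_mul meet_r // sinv_dom. Qed.

Lemma mulVK s : mul (mul s (inv s)) s = s.
Proof. by rewrite mulV lbid_dom_mul. Qed.

Lemma mulKV s : mul (mul (inv s) s) (inv s) = inv s.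
Proof. by rewrite Vmul lbid_dom_mul. Qed.

Lemma idempotent_lbid z : idempotent_elt mul (id_ z).
Proof. by rewrite /idempotent_elt -lbid_meet meetxx. Qed.

(** If [s s = s] then [s^-1 = s^-1 s s s^-1 = lbid V * lbid U], with [U] and [V]
the domains of [s] and [s^-1]; so [s^-1], and with it [s], is of this form. *)
Lemma idempotentE s : idempotent_elt mul s -> s = id_ (lb_dom s).
Proof.
rewrite /idempotent_elt => ss.
have sV : inv s = id_ (lb_dom (inv s) `&` lb_dom s).
  by rewrite lbid_meet -Vmul -mulV -mulA [mul s _]mulA ss mulA mulKV.
have sE : s = id_ (lb_dom (inv s) `&` lb_dom s) by rewrite -{1}[s]lbinvK {1}sV lbinv_lbid.
by rewrite [in RHS]sE dom_lbid.
Qed.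

Lemma idempotentC s t :
  idempotent_elt mul s -> idempotent_elt mul t -> mul s t = mul t s.
Proof. by move=> /idempotentE -> /idempotentE ->; rewrite -!lbid_meet meetC. Qed.

(** The classical consequence of idempotents commuting: both [t] and [s^-1]
equal [t s s^-1]. *)
Lemma inv_unique s t :
  mul (mul s t) s = s -> mul (mul t s) t = t -> t = inv s.
Proof.
move=> sts tst.
have i1 : idempotent_elt mul (mul s t) by rewrite /idempotent_elt mulA sts.
have i2 : idempotent_elt mul (mul t s) by rewrite /idempotent_elt mulA tst.
have i3 : idempotent_elt mul (mul s (inv s)) by rewrite /idempotent_elt mulA mulVK.
have i4 : idempotent_elt mul (mul (inv s) s) by rewrite /idempotent_elt mulA mulKV.
have tE : mul t (mul s (inv s)) = t.
  by rewrite -{1}tst -(mulA t) -mulA (idempotentC i1 i3) (mulA _ s t) mulVK mulA tst.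
have VE : mul (mul t s) (inv s) = inv s.
  rewrite -{1}(mulKV s) mulA (idempotentC i2 i4) -(mulA (inv s) s) (mulA s t s).
  by rewrite sts mulKV.
by rewrite -[LHS]tE mulA.
Qed.

Lemma inverse_semigroup : is_inverse_semigroup mul inv.
Proof. by split; [exact: mulA|exact: mulVK|exact: mulKV|exact: inv_unique]. Qed.

(** * Natural order, completeness and distributivity *)

Lemma natural_leP s t :
  natural_le mul s t <-> forall a, sinv s a = sinv t a `&` lb_dom s.
Proof.
split=> [[e /idempotentE ->] -> a|st].
  rewrite -[lb_dom (mul _ _)]sinv_top !sinv_lbid_mul sinv_top meetCA.
  by rewrite (meet_l (sinv_dom t a)).
exists (id_ (lb_dom s)); first exact: idempotent_lbid.
by apply: lb_ext_sinv => a; rewrite sinv_lbid_mul meetC.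
Qed.

(** An idempotent [lbid z] moves across [v] from the right to the left, where it
becomes [lbid] of the pullback of [z] along [v]. *)
Lemma natural_le_mull s t v : natural_le mul s t -> natural_le mul (mul v s) (mul v t).
Proof.
case=> e /idempotentE -> ->; exists (id_ (sinv v (rval (lb_dom e))^*)).
  exact: idempotent_lbid.
rewrite !mulA; congr (mul _ t).
by apply: lb_ext_sinv => a; rewrite sinv_mul_lbid sinv_lbid_mul meetC.
Qed.

Lemma natural_le_mulr s t v : natural_le mul s t -> natural_le mul (mul s v) (mul t v).
Proof. by case=> e ie ->; exists e; rewrite ?mulA. Qed.

(** On each [lb_dom s] the upper bounds [j] and [t] both restrict to [s], so they
agree on the union of these domains, which is the domain of [j]. *)
Lemma natural_joinP (A : set (local_bisection Q)) j :
    (forall s, A s -> natural_le mul s j) ->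
    lb_dom j <= Sup [set lb_dom s | s in A]%classic -> natural_join mul A j.
Proof.
move=> Aj jA; split=> // t At; apply/natural_leP => a; apply/le_anti/andP; split.
  rewrite lexI sinv_dom andbT.
  have /meet_l <- := sinv_dom j a.
  apply: le_trans (leI2 (lexx _) jA) _; rewrite meet_Sup.
  apply: Sup_le => _ [_ [s As <-] <-].
  have /natural_leP <- := Aj s As.
  by have /natural_leP -> := At s As; rewrite leIl.
apply: le_trans (leI2 (lexx _) jA) _; rewrite meet_Sup.
apply: Sup_le => _ [_ [s As <-] <-].
have /natural_leP <- := At s As.
by have /natural_leP -> := Aj s As; rewrite leIl.
Qed.

(** If [s^-1 t = lbid z] then [lbid (lb_dom s) * t = s s^-1 t = s * lbid z], which is a
restriction of [s]. *)
Lemma compatible_agree s t a : idempotent_elt mul (mul (inv s) t) ->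
  sinv t a `&` lb_dom s <= sinv s a.
Proof.
move=> /idempotentE e; set z := lb_dom _ in e.
have: mul (id_ (lb_dom s)) t = mul s (id_ z) by rewrite -mulV -e mulA.
move=> /(congr1 (fun v => sinv v a)); rewrite sinv_lbid_mul sinv_mul_lbid meetC => ->.
exact: leIl.
Qed.

Lemma compatible_union (A : set (local_bisection Q)) :
  pairwise_compatible mul inv A ->
  exists2 j, natural_join mul A j & lb_dom j = Sup [set lb_dom s | s in A]%classic.
Proof.
move=> cA.
have agree s t a : A s -> A t -> sinv t a `&` lb_dom s <= sinv s a.
  by move=> As At; apply: compatible_agree; have [] := cA s t As At.
have [|j jE] := exists_lb_union agree.
  move=> s t a As At; apply: compatible_agree; rewrite lbinvK.
  by have [] := cA s t As At.
have jdom : lb_dom j = Sup [set lb_dom s | s in A]%classic.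
  by rewrite -sinv_top jE; congr Sup; apply: eq_imagel => s _; rewrite sinv_top.
exists j => //; apply: natural_joinP; rewrite ?jdom // => s As.
apply/natural_leP => a; apply/le_anti/andP; split.
  by rewrite lexI sinv_dom jE andbT; apply: Sup_ub; exists s.
rewrite jE meetC meet_Sup; apply: Sup_le => _ [_ [t At <-] <-].
by rewrite meetC agree.
Qed.

Lemma natural_le_anti s t : natural_le mul s t -> natural_le mul t s -> s = t.
Proof.
move=> /natural_leP st /natural_leP ts; apply: lb_ext_sinv => a.
by apply/le_anti/andP; split; rewrite [leLHS](st, ts) leIl.
Qed.

(** Joins are unique, so any join has the domain of the union. *)
Lemma natural_join_dom (A : set (local_bisection Q)) j :
  pairwise_compatible mul inv A -> natural_join mul A j ->
  lb_dom j = Sup [set lb_dom s | s in A]%classic.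
Proof.
move=> /compatible_union [k [Ak kA] <-] [Aj jA]; congr lb_dom.
by apply: natural_le_anti; [exact: jA|exact: kA].
Qed.

(** By [natural_joinP] only the domains matter, and those of products are values
of [sinv], which preserves joins. *)
Lemma complete_pseudogroup : is_complete_pseudogroup mul inv.
Proof.
split; first exact: inverse_semigroup.
  by move=> A /compatible_union [j Aj _]; exists j.
move=> A j t cA Aj; have jdom := natural_join_dom cA Aj.
split; apply: natural_joinP.
- by move=> _ [s As <-]; apply: natural_le_mull; exact: Aj.1.
- rewrite dom_mul jdom.
  have -> : (rval (Sup [set lb_dom s | s in A]%classic))^* =
      Sup [set (rval (lb_dom s))^* | s in A]%classic.
    by rewrite (@rmap_Sup _ Q) !image_comp.
  apply: sinv_Sup_le => _ [s As <-]; rewrite -dom_mul.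
  by apply: Sup_ub; exists (mul t s) => //; exists s.
- by move=> _ [s As <-]; apply: natural_le_mulr; exact: Aj.1.
rewrite dom_mul; set b := (rval _)^*.
have /meet_l <- := sinv_dom j b.
rewrite jdom meet_Sup; apply: Sup_le => _ [_ [s As <-] <-].
have /natural_leP <- := Aj.1 s As.
by rewrite -dom_mul; apply: Sup_ub; exists (mul s t) => //; exists s.
Qed.

End Pseudogroup.

Theorem theorem4p17 (d : Order.disp_t) (Q : openQuantalFrameType d)
    (W : weakly_multiplicative Q) :
  let mul := lb_prod (wm_lact W) in
  let eps := lbunit (wm_ups W) in
  [/\ is_complete_pseudogroup mul (@lbinv d Q),
      forall a : Q, lact eps a = a /\ ract a eps = a,
      forall s t : local_bisection Q, natural_le mul s t <->
        exists st : lb_dom s <= lb_dom t,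
          lb_map s = lcomp (lb_map t) (oincl st),
      exists phi : rside Q -> {e : local_bisection Q | idempotent_elt mul e},
        bijective phi /\
        forall z w : rside Q,
          sval (phi (z `&` w)) = mul (sval (phi z)) (sval (phi w)) &
      forall s t : local_bisection Q, natural_le mul s t ->
        forall a : Q, lact s a <= lact t a].
Proof.
split.
- exact: complete_pseudogroup.
- move=> a; rewrite /ract -lbid_unit lbinv_lbid lact_lbid ract_inv_lbid.
  by rewrite rval_top star_top meet1x meetx1.
- move=> s t; rewrite natural_leP; split=> [st|[dom_st st] a].
    have dom_st : lb_dom s <= lb_dom t by rewrite -(sinv_top s) st (sinv_top t) leIl.
    exists dom_st; apply: locmap_ext => a; apply: osval_inj; exact: st.
  by have /(congr1 (fun f => osval (linv f a))) := st.
- exists (fun z => exist _ _ (idempotent_lbid W z)); split; last first.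
    by move=> z w; exact: lbid_meet.
  exists (fun e => lb_dom (sval e)) => [z|[e ie]]; first exact: dom_lbid.
  by apply: eq_exist; rewrite -idempotentE.
move=> s t /natural_leP st a; apply: Sup_le => _ [x [y [xy <-]]].
apply: (@le_trans _ _ (rval (sinv t x) `&` y)).
  by apply: leI2 => //; rewrite le_rval st leIl.
by apply: Sup_ub; exists x, y.
Qed.
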